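(* Let $1\le k\le n-1$, let $a_1,\dots,a_n>0$ and let $E=\{x\in\mathbb{R}^n:\sum_{i=1}^n x_i^2/a_i^2\le1\}$. Let $W$ be a $k$-dimensional linear subspace of $\mathbb{R}^n$ with orthonormal basis $w_1,\dots,w_k$, and let $w_{k+1},\dots,w_n$ be an orthonormal basis of $W^\perp$. Let $\Omega$ be the $n\times k$ matrix with columns $w_1,\dots,w_k$ and $\Omega^\perp$ the $n\times(n-k)$ matrix with columns $w_{k+1},\dots,w_n$. Let $P$ and $P^\perp$ be the orthogonal projections onto $W$ and $W^\perp$. Then the $k$-dimensional volume of the projection $P(E)$ of $E$ onto $W$ is given by each of the following: $$\mathrm{vol}_kP(E)=\kappa_k\sqrt{\sum_{\mathbf i}P_{\mathbf i}\,a_{\mathbf i}^2}=\kappa_k\sqrt{\sum_{\mathbf i}\Omega_{\mathbf i}^2\,a_{\mathbf i}^2},$$ where the sums are over increasing $k$-multiindices $\mathbf i$ in $\{1,\dots,n\}$, and $$\mathrm{vol}_kP(E)=\kappa_k\prod_{i=1}^na_i\sqrt{\sum_{\mathbf j}\frac{P^\perp_{\mathbf j}}{a_{\mathbf j}^2}}=\kappa_k\prod_{i=1}^na_i\sqrt{\sum_{\mathbf j}\frac{(\Omega^\perp_{\mathbf j})^2}{a_{\mathbf j}^2}},$$ where the sums are over increasing $(n-k)$-multiindices $\mathbf j$ in $\{1,\dots,n\}$.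
   Context: $\kappa_k$ is the volume of the unit ball in $\mathbb{R}^k$. An increasing $m$-multiindex is $\mathbf i=(i_1,\dots,i_m)$ with $1\le i_1<\dots<i_m\le n$, and $a_{\mathbf i}=\prod_{l=1}^m a_{i_l}$. For an $n\times n$ matrix $M$ (such as $P$ or $P^\perp$ in the standard basis), $M_{\mathbf i}$ is the principal minor with rows and columns indexed by $\mathbf i$. For an $n\times m$ matrix $\Omega$ and an $m$-multiindex $\mathbf i$, $\Omega_{\mathbf i}$ is the $m\times m$ minor formed by the rows indexed by $\mathbf i$. *)

(* Defs.v *)
From HB Require Import structures.
From mathcomp Require Export all_boot all_order all_algebra.
From mathcomp Require Export all_classical all_reals all_analysis.

Set Implicit Arguments.
Unset Strict Implicit.
Unset Printing Implicit Defensive.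

Export Order.TTheory GRing.Theory Num.Theory.
Export numFieldNormedType.Exports.

Local Open Scope classical_set_scope.
Local Open Scope ring_scope.

(* k-dimensional Lebesgue measure on R^k, realised as k-tuples with the product
   sigma-algebra: the k-fold product of the one-dimensional measure, transported
   along R * R^k ~ R^k.+1. *)
Fixpoint lebesgue_tuple (R : realType) (k : nat) :
    set (k.-tuple (measurableTypeR R)) -> \bar R :=
  match k with
  | 0 => \d_ [tuple]
  | k'.+1 => pushforward (lebesgue_measure \x @lebesgue_tuple R k')%E
               (fun p : measurableTypeR R * k'.-tuple (measurableTypeR R) =>
                  cons_tuple p.1 p.2)
  end.

Section lebesgue_tuple_theory.
Context (R : realType).
Local Notation T := (measurableTypeR R).

Lemma measurable_cons_tuple (k : nat) :
  measurable_fun [set: T * k.-tuple T]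
    (fun p : T * k.-tuple T => cons_tuple p.1 p.2).
Proof. exact: measurable_cons. Qed.

Lemma measurable_uncons_tuple (k : nat) :
  measurable_fun [set: k.+1.-tuple T]
    (fun t : k.+1.-tuple T => (thead t, behead_tuple t) : T * k.-tuple T).
Proof.
apply/measurable_fun_pair; first exact: measurable_tnth.
apply/measurable_fun_tnthP => i.
rewrite (_ : _ \o _ = (fun t : k.+1.-tuple T => tnth t (lift ord0 i))).
  exact: measurable_tnth.
apply/funext => t /=; rewrite (tuple_eta t) tnthS.
by congr tnth; apply/val_inj.
Qed.

Section lebesgue_tuple_step.
Context (k : nat) (m : {sigma_finite_measure set (k.-tuple T) -> \bar R}).

Let f := fun p : T * k.-tuple T => cons_tuple p.1 p.2.
Let g := fun t : k.+1.-tuple T => (thead t, behead_tuple t) : T * k.-tuple T.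
Let prod := (@lebesgue_measure R \x m)%E.
HB.instance Definition _ := Measure.on prod.
Let push : set (k.+1.-tuple T) -> \bar R := pushforward prod f.

Let fK : cancel f g.
Proof. by case=> x t; rewrite /f /g/=; congr pair; apply/val_inj. Qed.

Let gK : cancel g f.
Proof. by move=> t; rewrite /f /g/=; exact/esym/tuple_eta. Qed.

Let mpre A : measurable A -> measurable (f @^-1` A).
Proof.
by move=> mA; rewrite -[X in measurable X]setTI; exact: measurable_cons_tuple.
Qed.

Let push0 : push set0 = 0%E.
Proof. by rewrite /push /pushforward preimage_set0 measure0. Qed.

Let push_ge0 A : (0 <= push A)%E.
Proof. by apply: integral_ge0 => x _; exact: measure_ge0. Qed.

Let push_sigma_additive : semi_sigma_additive push.
Proof.
move=> F mF tF mUF; rewrite /push /pushforward preimage_bigcup.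
apply: measure_semi_sigma_additive.
- by move=> n; exact: mpre.
- apply/trivIsetP => /= i j _ _ ij; rewrite -preimage_setI.
  by move/trivIsetP : tF => /(_ _ _ _ _ ij) ->//; rewrite preimage_set0.
- by rewrite -preimage_bigcup; exact: mpre.
Qed.

HB.instance Definition _ :=
  isMeasure.Build _ _ _ push push0 push_ge0 push_sigma_additive.

Let push_sigma_finite : sigma_finite setT push.
Proof.
have /sigma_finiteP[F [FT ndF mF]] := sigma_finiteT (@lebesgue_measure R).
have /sigma_finiteP[G [GT ndG mG]] := sigma_finiteT m.
exists (fun n => g @^-1` (F n `*` G n)).
  apply/esym; rewrite -subTset => t _.
  have [i _ Fi] : (\bigcup_i F i) (g t).1 by rewrite -FT.
  have [j _ Gj] : (\bigcup_i G i) (g t).2 by rewrite -GT.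
  exists (maxn i j) => //; split.
  - by move: Fi; exact/subsetPset/ndF/leq_maxl.
  - by move: Gj; exact/subsetPset/ndG/leq_maxr.
move=> n; have [mFn Fnoo] := mF n; have [mGn Gnoo] := mG n; split.
  rewrite -[X in measurable X]setTI; apply: measurable_uncons_tuple => //.
  exact: measurableX.
rewrite /push /pushforward (_ : f @^-1` _ = F n `*` G n).
  by rewrite /prod product_measure1E// lte_mul_pinfty// ge0_fin_numE.
by apply/seteqP; split => x; rewrite /preimage /mkset fK.
Qed.

HB.instance Definition _ :=
  Measure_isSigmaFinite.Build _ _ _ push push_sigma_finite.

Lemma pushforward_cons_sigma_finite :
  exists m' : {sigma_finite_measure set (k.+1.-tuple T) -> \bar R},
    pushforward (@lebesgue_measure R \x m)%E f = m'.
Proof. by exists push. Qed.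

End lebesgue_tuple_step.

Lemma lebesgue_tuple_sigma_finite (k : nat) :
  exists m : {sigma_finite_measure set (k.-tuple T) -> \bar R},
    @lebesgue_tuple R k = m.
Proof.
elim: k => [|k [m em]]; first by exists (\d_ [tuple]).
by rewrite /= em; exact: pushforward_cons_sigma_finite.
Qed.

Lemma lebesgue_tuple_box (k : nat) (A : 'I_k -> set T) :
  (forall i, measurable (A i)) ->
  lebesgue_tuple [set t : k.-tuple T | forall i, A i (tnth t i)] =
  (\prod_i lebesgue_measure (A i))%E.
Proof.
elim: k A => [A _|k IH A mA].
  by rewrite big_ord0 /= diracE mem_set// => -[].
have [m em] := lebesgue_tuple_sigma_finite k.
rewrite big_ord_recl /= /pushforward.
rewrite [X in product_measure1 _ _ X](_ : _ = A ord0 `*`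
    [set t : k.-tuple T | forall i, A (lift ord0 i) (tnth t i)]).
  rewrite -IH// em product_measure1E//.
  rewrite (_ : [set t : k.-tuple T | _] = \big[setI/setT]_(i < k)
      ((fun t : k.-tuple T => tnth t i) @^-1` A (lift ord0 i))).
    apply: bigsetI_measurable => i _.
    by rewrite -[X in measurable X]setTI; exact: measurable_tnth.
  apply/seteqP; split=> t /=; rewrite -bigcap_seq.
    by move=> h i _ /=.
  by move=> h i; apply: (h i); rewrite /= mem_index_enum.
apply/seteqP; split=> -[x t] /=.
  move=> h; split; first exact: (h ord0).
  by move=> i; have := h (lift ord0 i); rewrite tnthS.
move=> [h0 h] i; case: (unliftP ord0 i) => [j ->|->//].
by rewrite tnthS.
Qed.

End lebesgue_tuple_theory.

Section euclidean.
Context (R : realType).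

Definition dotc (n : nat) (x y : 'cV[R]_n) : R := \sum_i x i 0 * y i 0.

Definition orthocomplement (n : nat) (W : set 'cV[R]_n) : set 'cV[R]_n :=
  [set y | forall x, W x -> dotc x y = 0].

(* The columns of [B] are an orthonormal basis of [W]; linear independence
   follows from orthonormality. *)
Definition orthonormal_basis (n m : nat) (W : set 'cV[R]_n) (B : 'M[R]_(n, m)) :=
  (forall i j, dotc (col i B) (col j B) = (i == j)%:R) /\
  (forall x, W x <-> exists c : 'I_m -> R, x = \sum_j c j *: col j B).

Definition orthogonal_projection (n : nat) (W : set 'cV[R]_n) (P : 'M[R]_n) :=
  forall x, W (P *m x) /\ orthocomplement W (x - P *m x).

(* k-dimensional volume, in a k-dimensional subspace [W], of a set [S] of vectors
   of [W]: Lebesgue measure after identifying [W] with R^k by means of an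
   orthonormal basis. The basis is picked by [xget], so the value depends only on
   [W] and [S]; any other orthonormal basis gives the same value because Lebesgue
   measure is invariant under orthogonal maps. *)
Definition subspace_volume (n k : nat) (W S : set 'cV[R]_n) : \bar R :=
  let B := xget (0 : 'M[R]_(n, k)) [set B | orthonormal_basis W B] in
  lebesgue_tuple
    [set c : k.-tuple (measurableTypeR R) | S (\sum_j (tnth c j : R) *: col j B)].

Definition unit_ball_volume (k : nat) : \bar R :=
  lebesgue_tuple
    [set c : k.-tuple (measurableTypeR R) | \sum_j (tnth c j : R) ^+ 2 <= 1].

Definition ellipsoid (n : nat) (a : 'I_n -> R) : set 'cV[R]_n :=
  [set x | \sum_i x i 0 ^+ 2 / a i ^+ 2 <= 1].

Definition increasing (n m : nat) (i : {ffun 'I_m -> 'I_n}) : bool :=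
  [forall s : 'I_m, forall t : 'I_m, (s < t)%N ==> (i s < i t)%N].

Definition multi_prod (n m : nat) (a : 'I_n -> R) (i : {ffun 'I_m -> 'I_n}) : R :=
  \prod_l a (i l).

Definition principal_minor (n m : nat) (M : 'M[R]_n) (i : {ffun 'I_m -> 'I_n}) : R :=
  \det (mxsub i i M).

Definition row_minor (n m : nat) (M : 'M[R]_(n, m)) (i : {ffun 'I_m -> 'I_n}) : R :=
  \det (rowsub i M).

End euclidean.

(* Main.v *)
Require Import Defs.
From mathcomp Require Import fingroup perm measurable_realfun.

(** Let [B] be an orthonormal basis of [W], [D = diag a] and [M = B^T D]. In the
    coordinates given by [B] the projection of the ellipsoid is the image under
    [M] of the unit ball of R^n. An inverse Cholesky factor [U] of the Gram
    matrix [M M^T] makes [U M] a coisometry, which maps the unit ball of R^n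
    onto that of R^k; so the projection is the preimage of the unit ball of R^k
    under the lower triangular map [U], and Fubini's theorem alone gives its
    volume [kappa / det U = kappa * sqrt (det (M M^T))]. The Cauchy-Binet
    formula expands [det (B^T D^2 B)] into minors, and [P = B B^T] identifies
    the squared minors of any orthonormal basis with the principal minors of
    [P]. The formulas on the orthogonal complement follow from the identity
    [det S * det (O2^T S^-1 O2) = det (O1^T S O1)] for complementary
    orthonormal frames [O1], [O2]. *)

Set Implicit Arguments.
Unset Strict Implicit.
Unset Printing Implicit Defensive.

Local Open Scope classical_set_scope.
Local Open Scope ring_scope.

(** * Increasing multiindices as representatives of injective maps up to permutation *)

Section IncreasingMultiindices.
Context (n m : nat).
Implicit Types (f i : {ffun 'I_m -> 'I_n}) (s t : 'S_m).

Lemma increasingP i :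
  reflect (forall a b : 'I_m, (a < b)%N -> (i a < i b)%N) (increasing i).
Proof.
apply: (iffP forallP) => [h a b|h a]; first by move/forallP/(_ b)/implyP: (h a).
by apply/forallP => b; apply/implyP; exact: h.
Qed.

Lemma increasing_inj i : increasing i -> injective i.
Proof.
move=> /increasingP hi a b eab; apply/val_inj; case: (ltngtP a b) => // /hi;
by rewrite eab ltnn.
Qed.

(** The permutation [t] inherits strict monotonicity from [i] and [i'], and a strictly increasing
    self-map of ['I_m] never drops below the identity. *)
Lemma increasing_perm_ge i i' t : increasing i -> increasing i' ->
  (forall a, i a = i' (t a)) -> forall a : 'I_m, (a <= t a)%N.
Proof.
move=> /increasingP hi /increasingP hi' e.
have ht (a b : 'I_m) : (a < b)%N -> (t a < t b)%N.
  move=> /hi; rewrite !e; case: (ltngtP (t a) (t b)) => // [/hi'|/val_inj ->].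
    by move=> /ltnW; rewrite leqNgt => /negbTE ->.
  by rewrite ltnn.
move=> [a]; elim: a => // a IH lt_a1m.
by apply: leq_ltn_trans (IH (ltnW lt_a1m)) _; exact: ht.
Qed.

(** The previous bound, applied to [t] and to its inverse, squeezes [t a] to [a]. *)
Lemma increasing_perm_uniq i i' t : increasing i -> increasing i' ->
  (forall a, i a = i' (t a)) -> t = 1%g.
Proof.
move=> hi hi' e; apply/permP => a; rewrite perm1; apply/val_inj/anti_leq.
rewrite (increasing_perm_ge hi hi' e) andbT.
have e' b : i' b = i (t^-1%g b) by rewrite e permKV.
by have := increasing_perm_ge hi' hi e' (t a); rewrite permK.
Qed.

Lemma increasing_sort f :
  injective f -> exists s, increasing [ffun a => f (s a)].
Proof.
move=> fI; pose r := [rel a b : 'I_m | (f a <= f b)%N].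
have rT : total r by move=> a b; exact: leq_total.
have rt : transitive r by move=> a b c; exact: leq_trans.
have /tuple_permP[s es] : perm_eq (sort r (ord_tuple m)) (ord_tuple m).
  by rewrite perm_sort.
exists s; apply/increasingP => a b ltab; rewrite !ffunE.
have := sort_sorted rT (ord_tuple m).
rewrite es sorted_pairwise//.
move=> /(pairwiseP a)/(_ a b); rewrite !inE !size_tuple.
rewrite !ltn_ord => /(_ isT isT ltab).
(* Sorting positions by their value under [f] yields only a weak inequality; injectivity of [f]
   excludes ties. *)
rewrite -!tnth_nth !tnth_mktuple !tnth_ord_tuple /= leq_eqVlt => /orP[/eqP|//].
by move=> /val_inj/fI/perm_inj eab; rewrite eab ltnn in ltab.
Qed.

(** An injective map factors uniquely as a permutation followed by an increasing multiindex: sorting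
    gives existence, [increasing_perm_uniq] uniqueness. *)
Lemma big_injective_increasing (V : nmodType) (F : {ffun 'I_m -> 'I_n} -> V) :
  \sum_(f : {ffun 'I_m -> 'I_n} | injectiveb f) F f =
  \sum_(i : {ffun 'I_m -> 'I_n} | increasing i) \sum_(s : 'S_m)
    F [ffun a => i (s a)].
Proof.
pose h (p : {ffun 'I_m -> 'I_n} * 'S_m) := [ffun a => p.1 (p.2 a)].
(* A choice of factorization; the default is returned only when [f] is not injective. *)
pose h' f := odflt (f, 1%g) [pick p | increasing p.1 && (h p == f)].
have h'P f : injectiveb f -> increasing (h' f).1 /\ h (h' f) = f.
  move=> /injectiveP fI; rewrite /h'; case: pickP => [p /andP[? /eqP//]|no].
  have [s hs] := increasing_sort fI.
  have /negbT/negP[] := no ([ffun a => f (s a)], s^-1%g); rewrite hs /=.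
  by apply/eqP/ffunP => a; rewrite !ffunE /= permKV.
rewrite (reindex_onto h h') => [|f /h'P[]//].
rewrite pair_big_dep /=; apply: eq_big => // -[i s] /=; rewrite andbT.
(* Uniqueness enters here: [h'] recovers [(i, s)] from [h (i, s)] exactly when [i] is increasing. *)
apply/idP/idP => [/andP[/h'P[+ _] /eqP e]|hi]; first by rewrite e.
have hI : injectiveb (h (i, s)).
  by apply/injectiveP => a b; rewrite !ffunE => /(increasing_inj hi)/perm_inj.
rewrite hI /=; have [] := h'P _ hI; case: (h' _) => i' s' /= hi' e.
have e' a : i a = i' ((s^-1 * s')%g a).
  by move/ffunP/(_ (s^-1%g a)): e; rewrite !ffunE /= permKV permM.
have t1 := increasing_perm_uniq hi hi' e'.
have -> : s' = s by rewrite -[s']mul1g -(mulgV s) -mulgA t1 mulg1.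
by apply/eqP; congr pair; apply/ffunP => a; rewrite e' t1 perm1.
Qed.

End IncreasingMultiindices.

(** * Determinant identities and triangular factorization *)

Theorem Cauchy_Binet (R : comPzRingType) (m n : nat)
    (A : 'M[R]_(m, n)) (B : 'M[R]_(n, m)) :
  \det (A *m B) = \sum_(i : {ffun 'I_m -> 'I_n} | increasing i)
                     \det (colsub i A) * \det (rowsub i B).
Proof.
(* Distributing the Leibniz product over the entries of [A *m B] gives a sum over all maps [f]; the
   sum over permutations then reassembles a minor of [B]. *)
transitivity (\sum_(f : {ffun 'I_m -> 'I_n})
                \prod_a A a (f a) * \det (rowsub f B)).
  under [RHS]eq_bigr do rewrite big_distrr /=.
  rewrite exchange_big; apply: eq_bigr => s _ /=.
  under eq_bigr do rewrite mxE.
  rewrite bigA_distr_bigA big_distrr /=; apply: eq_bigr => f _.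
  rewrite big_split /= mulrCA; congr (_ * (_ * _)).
  by apply: eq_bigr => a _; rewrite mxE.
(* A non-injective [f] repeats a row of [B], so its minor vanishes. *)
rewrite (bigID (fun f : {ffun _ -> _} => injectiveb f)) /= addrC.
rewrite big1 ?add0r; last first.
  move=> f /injectivePn[a [b ab eab]].
  by rewrite (determinant_alternate ab) ?mulr0// => j; rewrite !mxE eab.
rewrite big_injective_increasing; apply: eq_bigr => i _.
rewrite big_distrl /=; apply: eq_bigr => s _.
(* Sorting the rows costs the sign of [s], which completes the Leibniz expansion of the minor of
   [A]. *)
have -> : rowsub [ffun a => i (s a)] B = row_perm s (rowsub i B).
  by apply/matrixP => a b; rewrite !mxE ffunE.
rewrite row_permE det_mulmx det_perm mulrCA mulrA; congr (_ * _ * _).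
by apply: eq_bigr => a _; rewrite !mxE ffunE.
Qed.

(** A form of Jacobi's complementary minor identity: in the orthogonal frame [Q], multiplying [S] by
    a suitable block triangular [K] gives a block triangular matrix, and determinants are
    compared. *)
Lemma det_compl_orthonormal (R : comUnitRingType) (n k m : nat)
    (O1 : 'M[R]_(n, k)) (O2 : 'M[R]_(n, m)) (S T : 'M[R]_n) :
  n = (k + m)%N -> O1^T *m O1 = 1%:M -> O2^T *m O2 = 1%:M ->
  O1^T *m O2 = 0 -> S *m T = 1%:M ->
  \det S * \det (O2^T *m T *m O2) = \det (O1^T *m S *m O1).
Proof.
move=> e; subst n => h1 h2 h12 ST; pose Q := row_mx O1 O2.
have h21 : O2^T *m O1 = 0 by apply: trmx_inj; rewrite trmx_mul trmxK h12 trmx0.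
have QTQ : Q^T *m Q = 1%:M.
  by rewrite tr_row_mx mul_col_row h1 h2 h12 h21 -scalar_mx_block.
have QQT := mulmx1C QTQ.
have dQ : \det Q^T * \det Q = 1 by rewrite -det_mulmx QTQ det1.
(* The columns of [K] are the coordinates of [O1] and [T *m O2] in the frame [Q]. *)
pose K := block_mx 1%:M (O1^T *m T *m O2) 0 (O2^T *m T *m O2).
have QK : Q *m K = row_mx O1 (T *m O2).
  rewrite mul_row_block mulmx1 mulmx0 addr0; congr row_mx.
  rewrite -[RHS]mul1mx -QQT tr_row_mx mul_row_col mulmxDl.
  by rewrite !mulmxA.
have : Q^T *m S *m Q *m K =
    block_mx (O1^T *m S *m O1) 0 (O2^T *m S *m O1) 1%:M.
  rewrite -!mulmxA QK mul_mx_row mulmxA ST mul1mx tr_row_mx mul_col_row.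
  by rewrite h12 h2.
move/(congr1 determinant).
rewrite det_lblock det1 mulr1 !det_mulmx det_ublock det1 mul1r => <-.
by congr (_ * _); rewrite -[LHS]mul1r -dQ mulrAC.
Qed.

(** Induction on the size: eliminating the first coordinate leaves the Schur complement [S], which
    is again symmetric and positive definite. *)
Lemma inverse_cholesky (R : rcfType) (k : nat) (Q : 'M[R]_k) :
  Q^T = Q -> (forall y : 'cV_k, y != 0 -> 0 < (y^T *m Q *m y) 0 0) ->
  exists U : 'M[R]_k,
    [/\ is_trig_mx U, forall i, 0 < U i i & U *m Q *m U^T = 1%:M].
Proof.
elim: k Q => [|k IH]; last rewrite -[k.+1]/(1 + k)%N; move=> Q symQ posQ.
  by exists 0; split; [exact: mx0_is_trig|case|apply/matrixP => -[]].
pose v : 'cV[R]_k := @dlsubmx _ 1 k 1 k Q.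
pose Q' : 'M[R]_k := @drsubmx _ 1 k 1 k Q.
pose q := Q 0 0; pose s := Num.sqrt q.
have eQ : Q = block_mx (q%:M : 'M[R]_1) v^T v Q'.
  have -> : v^T = @ursubmx _ 1 k 1 k Q by rewrite /v trmx_dlsub symQ.
  have -> : q%:M = @ulsubmx _ 1 k 1 k Q.
    by rewrite [RHS]mx11_scalar !mxE; congr (Q _ _)%:M; apply/val_inj.
  by rewrite submxK.
have q0 : 0 < q.
  have /posQ : delta_mx 0 0 != 0 :> 'cV[R]_(1 + k).
    by apply/eqP => /matrixP/(_ 0 0)/eqP; rewrite !mxE oner_eq0.
  by rewrite trmx_delta -rowE -colE !mxE.
have s0 : 0 < s by rewrite sqrtr_gt0.
have ssq : s * s = q by rewrite -expr2 sqr_sqrtr// ltW.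
pose S := Q' - q^-1 *: (v *m v^T).
have symS : S^T = S.
  rewrite /S linearB linearZ /= trmx_mul trmxK; congr (_ - _).
  by rewrite /Q' trmx_drsub symQ.
have posS (y : 'cV_k) : y != 0 -> 0 < (y^T *m S *m y) 0 0.
  move=> y0.
  (* [z] minimises the quadratic form over its first coordinate. *)
  pose z : 'cV[R]_(1 + k) := col_mx (- q^-1 *: (v^T *m y)) y.
  have -> : y^T *m S *m y = z^T *m Q *m z.
    rewrite -[RHS]mulmxA eQ /z mul_block_col tr_col_mx mul_scalar_mx scalerA.
    rewrite mulrN divff ?gt_eqF// scaleN1r addNr mul_row_col mulmx0 add0r.
    rewrite -mulmxA; congr (_ *m _).
    by rewrite mulmxBl -scalemxAr addrC scaleNr -scalemxAl mulmxA.
  apply: posQ; apply: contra_neq y0 => z0.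
  by rewrite -[y](col_mxKd (- q^-1 *: (v^T *m y))) -/z z0 linear0.
have [V [trV posV VSV]] := IH S symS posS.
(* The corner normalizes the pivot [q] to 1, and the lower left block clears the column [v] before
   [V] normalizes [S]. *)
exists (block_mx ((s^-1)%:M : 'M[R]_1) 0 (- q^-1 *: (V *m v)) V); split.
- by rewrite is_trig_block_mx// eqxx scalar_mx_is_trig.
- move=> i; case: (@split_ordP 1 k i) => j ->.
    by rewrite block_mxEul mxE eqxx invr_gt0.
  by rewrite block_mxEdr.
- rewrite eQ mulmx_block tr_block_mx mulmx_block !mul0mx !addr0 !trmx0 !mulmx0.
  have -> : - q^-1 *: (V *m v) *m q%:M + V *m v = 0.
    by rewrite mul_mx_scalar scalerA mulrN divff ?gt_eqF// scaleN1r addNr.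
  have -> : - q^-1 *: (V *m v) *m v^T + V *m Q' = V *m S.
    by rewrite mulmxBr -scalemxAr -scalemxAl scaleNr mulmxA addrC.
  rewrite !mul0mx !add0r !addr0 VSV tr_scalar_mx -!scalar_mxM.
  rewrite [s^-1 * q]mulrC -ssq mulfK ?gt_eqF// divff ?gt_eqF//.
  rewrite linearZ /= trmx_mul !mul_scalar_mx -scalemxAl scalerA ssq mulrN.
  rewrite [RHS]scalar_mx_block; congr block_mx.
  by rewrite -{1}ssq invfM mulrA divff ?gt_eqF// mul1r scaleNr addNr.
Qed.

(** * Lebesgue measure under affine and triangular maps *)

Section AffineLebesgue.
Context (R : realType).
Local Notation T := (measurableTypeR R).
Local Notation mu := (@lebesgue_measure R).

Lemma measurable_affine (u b : R) :
  measurable_fun [set: T] (fun x : T => (u * x + b)%R : T).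
Proof.
apply: measurable_funD; last exact: measurable_cst.
by apply: measurable_funM; [exact: measurable_cst|exact: measurable_id].
Qed.

Lemma lebesgue_measure_affine (u b : R) (A : set T) : 0 < u -> measurable A ->
  mu ((fun x : T => (u * x + b)%R : T) @^-1` A) = (u^-1%:E * mu A)%E.
Proof.
move=> u0 mA; pose f x : T := u * x + b.
(* The pushforward rescaled by [u] agrees with [mu] on half-open intervals, hence everywhere by
   uniqueness of Lebesgue measure. *)
pose nu := mscale (NngNum (ltW u0)) (pushforward mu f).
suff -> : mu A = nu (measurable_affine u b) A.
  by rewrite /nu /mscale /= muleA -EFinM mulVf ?gt_eqF// mul1e.
apply: lebesgue_measure_unique mA => _ [[c d] _ <-].
rewrite /nu /= /mscale /pushforward /=.
rewrite [X in (_ * X)%E](_ : _ = mu `](c - b) / u, (d - b) / u]%classic).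
  rewrite !lebesgue_measure_itv /= !lte_fin ltr_pM2r ?invr_gt0// ltrD2r.
  case: ifPn => _; last by rewrite mule0.
  rewrite -!EFinB -EFinM -mulrBl mulrCA divff ?gt_eqF// mulr1.
  by rewrite opprB addrA subrK.
congr (mu _); apply/seteqP; split => x /=; rewrite !in_itv /= /f;
by rewrite ltr_pdivrMr// ler_pdivlMr// ltrBlDr lerBrDr [x * u]mulrC.
Qed.

Lemma ge0_integral_affine (u b : R) (g : T -> \bar R) :
  0 < u -> measurable_fun [set: T] g -> (forall x, 0 <= g x)%E ->
  (\int[mu]_x g (u * x + b)%R = u^-1%:E * \int[mu]_x g x)%E.
Proof.
move=> u0 mg g0; have mf := measurable_affine u b.
have ui0 : 0 <= u^-1 by rewrite invr_ge0 ltW.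
transitivity (\int[mscale (NngNum ui0) mu]_x g x)%E; last first.
  by rewrite ge0_integral_mscale.
have := ge0_integral_pushforward mf mu measurableT mg (fun x _ => g0 x).
rewrite preimage_setT => <-; apply: eq_measure_integral => // A mA _.
exact: lebesgue_measure_affine.
Qed.

End AffineLebesgue.

(* The translation [b] is needed for the induction: with the first coordinate
   frozen, a triangular linear map acts affinely on the remaining ones. *)
Lemma lebesgue_tuple_trig (R : realType) (k : nat) (U : 'I_k -> 'I_k -> R)
    (b : 'I_k -> R) (A : set (k.-tuple (measurableTypeR R))) :
  (forall i j : 'I_k, (i < j)%N -> U i j = 0) -> (forall i, 0 < U i i) ->
  measurable A ->
  lebesgue_tuple [set t : k.-tuple (measurableTypeR R) |
    A [tuple \sum_j U i j * tnth t j + b i | i < k]] =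
  ((\prod_i U i i)^-1%:E * lebesgue_tuple A)%E.
Proof.
elim: k U b A => [|k IH] U b A trU posU mA.
  rewrite big_ord0 invr1 mul1e; congr lebesgue_tuple; apply/seteqP.
  by split=> t /=; rewrite (_ : mktuple _ = t)//;
    rewrite [LHS]tuple0 [RHS]tuple0.
(* Sigma-finiteness is what makes the measure of a section measurable in the first coordinate. *)
have [m em] := lebesgue_tuple_sigma_finite R k.
pose f (p : measurableTypeR R * k.-tuple (measurableTypeR R)) :=
  cons_tuple p.1 p.2.
have mfA : measurable (f @^-1` A).
  by rewrite -[X in measurable X]setTI; exact: measurable_cons_tuple.
rewrite [LHS]/= [X in (_ * X)%E]/= /pushforward em /product_measure1 /=.
pose U' i j := U (lift ord0 i) (lift ord0 j).
rewrite big_ord_recl /= invfM EFinM -muleA muleCA.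
pose g x := m (xsection (f @^-1` A) x).
transitivity (\int[lebesgue_measure]_x
    ((\prod_i U' i i)^-1%:E * g (U ord0 ord0 * x + b ord0)%R))%E.
  apply: eq_integral => x _.
  pose b' i := U (lift ord0 i) ord0 * x + b (lift ord0 i).
  have mB : measurable (xsection (f @^-1` A) (U ord0 ord0 * x + b ord0)%R).
    exact: measurable_xsection.
  rewrite /g -em -(IH U' b' _ _ _ mB) ; last 2 first.
  - by move=> i j ij; rewrite /U' trU.
  - by move=> i; exact: posU.
  (* By triangularity the first output coordinate depends on [x] alone; [b'] absorbs the
     contribution of [x] to the others. *)
  have e (t : k.-tuple (measurableTypeR R)) :
      [tuple \sum_j U i j * tnth (cons_tuple x t) j + b i | i < k.+1] =
      cons_tuple (U ord0 ord0 * x + b ord0)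
        [tuple \sum_j U' i j * tnth t j + b' i | i < k].
    apply: eq_from_tnth => i; rewrite tnth_mktuple big_ord_recl tnth0.
    under eq_bigr do rewrite tnthS.
    case: (unliftP ord0 i) => [j|] ->; last first.
      by rewrite tnth0 big1 ?addr0// => j _; rewrite trU ?mul0r.
    by rewrite tnthS tnth_mktuple /b' addrA [_ + U _ _ * x]addrC.
  by congr lebesgue_tuple; apply/seteqP; split => t /=;
    rewrite /xsection /= !in_setE /= /f /= e.
have mg : measurable_fun setT g by exact: measurable_fun_xsection.
rewrite ge0_integralZl//; last 2 first.
- exact: (measurableT_comp mg (measurable_affine _ _)).
- by rewrite lee_fin invr_ge0 prodr_ge0// => i _; exact/ltW/posU.
by rewrite ge0_integral_affine// muleCA.
Qed.

Lemma measurable_unit_ball (R : realType) (k : nat) :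
  measurable [set c : k.-tuple (measurableTypeR R) |
    \sum_j (tnth c j : R) ^+ 2 <= 1].
Proof.
pose f (c : k.-tuple (measurableTypeR R)) : R := \sum_j (tnth c j : R) ^+ 2.
have mf : measurable_fun setT f.
  apply: measurable_sum => j; apply: measurable_funX; exact: measurable_tnth.
have := measurable_fun_ler mf (measurable_cst (1 : R)) measurableT
  (Y := [set true]) I.
by rewrite setTI; congr measurable; apply/seteqP; split.
Qed.

(** * Orthonormal bases, projections, coisometries and ellipsoids *)

Section EuclideanGeometry.
Context (R : realType).

Lemma dotcE n (x y : 'cV[R]_n) : dotc x y = (x^T *m y) 0 0.
Proof. by rewrite mxE; apply: eq_bigr => i _; rewrite mxE. Qed.

Lemma sum_scale_col n m (B : 'M[R]_(n, m)) (c : 'I_m -> R) :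
  \sum_j c j *: col j B = B *m \col_j c j.
Proof.
apply/matrixP => i j; rewrite summxE mxE; apply: eq_bigr => l _.
by rewrite !mxE mulrC.
Qed.

Section OrthonormalBasis.
Context (n m : nat) (W : set 'cV[R]_n) (B : 'M[R]_(n, m)).
Hypothesis WB : orthonormal_basis W B.

Lemma orthonormal_basis_mul_tr : B^T *m B = 1%:M.
Proof.
case: WB => onB _; apply/matrixP => i j; rewrite [RHS]mxE -onB mxE.
by apply: eq_bigr => l _; rewrite !mxE.
Qed.

Lemma orthonormal_basisP x : W x <-> exists y : 'cV[R]_m, x = B *m y.
Proof.
case: WB => _ spanB; rewrite spanB; split => [[c ->]|[y ->]].
  by exists (\col_j c j); rewrite sum_scale_col.
exists (fun j => y j 0); rewrite sum_scale_col; congr (_ *m _).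
by apply/matrixP => i j; rewrite mxE [j]ord1.
Qed.

Lemma orthonormal_basis_col i : W (col i B).
Proof. by apply/orthonormal_basisP; exists (delta_mx i 0); rewrite colE. Qed.

(** Since [x - P *m x] is orthogonal to [W], both [x] and [P *m x] have the same coordinates against
    [B]. The formula holds for every orthonormal basis, so minors of different bases can be compared
    through [P]. *)
Lemma orthogonal_projectionE (P : 'M[R]_n) :
  orthogonal_projection W P -> P = B *m B^T.
Proof.
move=> projP.
suff Px (x : 'cV[R]_n) : P *m x = B *m B^T *m x.
  by apply/matrixP => i j; have /matrixP/(_ i 0) := Px (delta_mx j 0);
    rewrite -!colE !mxE.
have [/orthonormal_basisP[y Pxy] orth] := projP x.
have BTx : B^T *m x = B^T *m (P *m x).
  apply/eqP; rewrite -subr_eq0 -mulmxBr; apply/eqP/matrixP => i j.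
  have := orth _ (orthonormal_basis_col i).
  by rewrite dotcE tr_col -row_mul !mxE [j]ord1.
rewrite -mulmxA BTx Pxy; congr (_ *m _).
by rewrite mulmxA orthonormal_basis_mul_tr mul1mx.
Qed.

End OrthonormalBasis.

Definition sqnorm n (x : 'cV[R]_n) : R := (x^T *m x) 0 0.

Lemma sqnormE n (x : 'cV[R]_n) : sqnorm x = \sum_i x i 0 ^+ 2.
Proof. by rewrite /sqnorm mxE; apply: eq_bigr => i _; rewrite mxE expr2. Qed.

Lemma sqnorm_gt0 n (x : 'cV[R]_n) : x != 0 -> 0 < sqnorm x.
Proof.
move=> x0; rewrite sqnormE lt_neqAle sumr_ge0 ?andbT => [|i _]; last first.
  exact: sqr_ge0.
apply: contra_neq x0 => /esym/psumr_eq0P h; apply/matrixP => i j.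
by rewrite [j]ord1 mxE; apply/eqP; rewrite -sqrf_eq0 h// => l _; exact: sqr_ge0.
Qed.

(** [N^T *m z] is a preimage of [z] of the same norm. Conversely [N] is a contraction, by Pythagoras
    for the projection [N^T *m N]. *)
Lemma coisometry_ball m n (N : 'M[R]_(m, n)) (z : 'cV[R]_m) :
  N *m N^T = 1%:M ->
  (exists2 y : 'cV[R]_n, sqnorm y <= 1 & N *m y = z) <-> sqnorm z <= 1.
Proof.
move=> NNT; split=> [[y y1 <-]|z1]; last first.
  exists (N^T *m z); last by rewrite mulmxA NNT mul1mx.
  by rewrite /sqnorm trmx_mul trmxK mulmxA -[_ *m N *m _]mulmxA NNT mulmx1.
apply: le_trans y1; rewrite -subr_ge0.
suff -> : sqnorm y - sqnorm (N *m y) = sqnorm (y - N^T *m (N *m y)).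
  by rewrite sqnormE sumr_ge0// => i _; exact: sqr_ge0.
rewrite /sqnorm [(y - _)^T]linearB /= mulmxBl !mulmxBr !trmx_mul trmxK.
rewrite -!mulmxA [N *m (N^T *m _)]mulmxA NNT mul1mx.
by rewrite !mxE subrr subr0.
Qed.

Lemma ellipsoidE n (a : 'I_n -> R) : (forall i, 0 < a i) ->
  ellipsoid a = [set diag_mx (\row_i a i) *m y | y in [set y | sqnorm y <= 1]].
Proof.
move=> a0; apply/seteqP; split=> [x /= x1|_ /= [y y1 <-]]; last first.
  rewrite /ellipsoid /=; apply: le_trans y1; rewrite sqnormE.
  apply: ler_sum => i _; rewrite mul_diag_mx !mxE exprMn mulrAC divff ?mul1r//.
  by rewrite sqrf_eq0 gt_eqF.
exists (\col_i (x i 0 / a i)).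
  rewrite sqnormE (le_trans _ x1)//; apply: ler_sum => i _.
  by rewrite mxE exprMn exprVn.
apply/matrixP => i j; rewrite [j]ord1 mul_diag_mx !mxE mulrCA divff ?mulr1//.
by rewrite gt_eqF.
Qed.

End EuclideanGeometry.

(** * Volumes of linear images of the ball, and Gram determinants *)

Lemma volume_linear_image_ball (R : realType) (n k : nat) (M : 'M[R]_(k, n)) :
  (forall y : 'cV_k, y != 0 -> M^T *m y != 0) ->
  lebesgue_tuple [set c : k.-tuple (measurableTypeR R) |
    exists2 y : 'cV[R]_n, sqnorm y <= 1 & M *m y = \col_j tnth c j] =
  (unit_ball_volume R k * (Num.sqrt (\det (M *m M^T)))%:E)%E.
Proof.
move=> Minj; have [||U [trU posU UU]] := @inverse_cholesky R k (M *m M^T).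
- by rewrite trmx_mul trmxK.
- move=> y /Minj/sqnorm_gt0; rewrite /sqnorm trmx_mul trmxK.
  by rewrite !mulmxA.
have dU : 0 < \det U by rewrite det_trig// prodr_gt0.
have -> : Num.sqrt (\det (M *m M^T)) = (\det U)^-1.
  have : \det U ^+ 2 * \det (M *m M^T) = 1.
    by rewrite -(det1 _ k) -UU !det_mulmx det_tr expr2 mulrAC.
  move=> /(canRL (mulKf _)) ->; last by rewrite sqrf_eq0 gt_eqF.
  by rewrite mulr1 -exprVn sqrtr_sqr ger0_norm// invr_ge0 ltW.
rewrite muleC det_trig// /unit_ball_volume.
rewrite -(lebesgue_tuple_trig (fun=> 0) _ posU (@measurable_unit_ball R k));
    last first.
  by move=> i l; move/is_trig_mxP: trU; exact.
have Uunit : U \in unitmx by rewrite unitmxE unitfE gt_eqF.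
congr lebesgue_tuple; apply/funext => c /=.
rewrite (_ : \sum_j _ = sqnorm (U *m \col_j tnth c j)); last first.
  rewrite sqnormE; apply: eq_bigr => i _; rewrite tnth_mktuple addr0 mxE.
  by congr (_ ^+ 2); apply: eq_bigr => l _; rewrite mxE.
(* The coisometry [U *m M] turns the norm bound on the image of [c] under [U] into the existence of
   a [y] in the unit ball; invertibility of [U] then cancels it. *)
apply/propext; rewrite -(@coisometry_ball R k n (U *m M)); last first.
  by rewrite trmx_mul !mulmxA -[U *m M *m _]mulmxA.
split=> -[y y1 My]; exists y => //; first by rewrite -mulmxA My.
by apply: (can_inj (mulKmx Uunit)); rewrite mulmxA.
Qed.

Section GramMinors.
Context (R : realType) (n m : nat) (B : 'M[R]_(n, m)).

Lemma det_gram_diag (d : 'I_n -> R) :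
  \det (B^T *m diag_mx (\row_i d i) *m B) =
  \sum_(i : {ffun 'I_m -> 'I_n} | increasing i)
     row_minor B i ^+ 2 * multi_prod d i.
Proof.
rewrite Cauchy_Binet; apply: eq_bigr => i _.
have -> : colsub i (B^T *m diag_mx (\row_i d i)) =
    (rowsub i B)^T *m diag_mx (\row_l d (i l)).
  by apply/matrixP => s t; rewrite !mul_mx_diag !mxE.
rewrite det_mulmx det_tr det_diag expr2 mulrAC; congr (_ * _).
by apply: eq_bigr => l _; rewrite mxE.
Qed.

(** The selected submatrix is a product of two square matrices, so its determinant is
    multiplicative. *)
Lemma principal_minor_mul_tr (i : {ffun 'I_m -> 'I_n}) :
  principal_minor (B *m B^T) i = row_minor B i ^+ 2.
Proof.
rewrite /principal_minor mxsub_mul det_mulmx expr2; congr (_ * _).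
rewrite /row_minor -[in RHS]det_tr; congr determinant.
by apply/matrixP => s t; rewrite !mxE.
Qed.

End GramMinors.

Lemma subspace_volume_ellipsoid (R : realType) (n k : nat) (a : 'I_n -> R)
    (W : set 'cV[R]_n) (P : 'M[R]_n) :
  (forall i, 0 < a i) -> (exists B : 'M[R]_(n, k), orthonormal_basis W B) ->
  orthogonal_projection W P ->
  subspace_volume k W [set P *m x | x in ellipsoid a] =
  (unit_ball_volume R k * (Num.sqrt
    (\sum_(i : {ffun 'I_k -> 'I_n} | increasing i)
       principal_minor P i * multi_prod a i ^+ 2))%:E)%E.
Proof.
move=> a0 [B0 WB0] projP; rewrite /subspace_volume.
(* [B0] rules out the default [0]; the basis [B] picked may differ from [B0]. *)
case: xgetP => [B _ WB|/(_ B0)/=]; last by move/(_ WB0).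
have BTB := orthonormal_basis_mul_tr WB.
rewrite (orthogonal_projectionE WB projP).
pose D := diag_mx (\row_i a i).
have -> : \sum_(i : {ffun 'I_k -> 'I_n} | increasing i)
    principal_minor (B *m B^T) i * multi_prod a i ^+ 2 =
    \det ((B^T *m D) *m (B^T *m D)^T).
  rewrite trmx_mul trmxK tr_diag_mx mulmxA -[B^T *m D *m _]mulmxA mulmx_diag.
  rewrite (_ : \row_i _ = \row_i (a i ^+ 2)).
    rewrite det_gram_diag; apply: eq_bigr => i _.
    by rewrite principal_minor_mul_tr /multi_prod prodrXl.
  by apply/rowP => i; rewrite !mxE expr2.
rewrite -volume_linear_image_ball; last first.
  (* The transpose is [D *m B], injective because [D] has a positive diagonal and [B] a left
     inverse. *)
  move=> y; apply: contra_neq => DBy; rewrite trmx_mul trmxK tr_diag_mx in DBy.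
  rewrite -[y]mul1mx -BTB -mulmxA (_ : B *m y = 0) ?mulmx0//.
  apply/matrixP => i j; move/matrixP/(_ i j): DBy.
  rewrite -mulmxA mul_diag_mx !mxE => /eqP; rewrite mulf_eq0 gt_eqF//=.
  by move/eqP.
congr lebesgue_tuple; apply/funext => c /=; apply/propext.
rewrite sum_scale_col ellipsoidE//; split=> [[_ [y y1 <-]]|[y y1 My]].
  move=> /(congr1 (mulmx B^T)); rewrite !mulmxA BTB !mul1mx => My.
  by exists y.
by exists (D *m y); [exists y|rewrite -My !mulmxA].
Qed.

(** * The volume formulas on the subspace and on its complement *)

Theorem theorem30 (R : realType) (n k : nat) (hk : (1 <= k <= n - 1)%N)
    (a : 'I_n -> R) (ha : forall i, 0 < a i)
    (W : {vspace 'cV[R]_n}) (hW : \dim W = k)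
    (Om : 'M[R]_(n, k)) (hOm : orthonormal_basis [set` W] Om)
    (Omp : 'M[R]_(n, n - k))
    (hOmp : orthonormal_basis (orthocomplement [set` W]) Omp)
    (P : 'M[R]_n) (hP : orthogonal_projection [set` W] P)
    (Pp : 'M[R]_n) (hPp : orthogonal_projection (orthocomplement [set` W]) Pp) :
  let vol := subspace_volume k [set` W] [set P *m x | x in ellipsoid a] in
  let kappa := unit_ball_volume R k in
  [/\ vol = (kappa * (Num.sqrt
        (\sum_(i : {ffun 'I_k -> 'I_n} | increasing i)
           principal_minor P i * multi_prod a i ^+ 2))%:E)%E,
      vol = (kappa * (Num.sqrt
        (\sum_(i : {ffun 'I_k -> 'I_n} | increasing i)
           row_minor Om i ^+ 2 * multi_prod a i ^+ 2))%:E)%E,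
      vol = (kappa * ((\prod_i a i) * Num.sqrt
        (\sum_(j : {ffun 'I_(n - k) -> 'I_n} | increasing j)
           principal_minor Pp j / multi_prod a j ^+ 2))%:E)%E
    & vol = (kappa * ((\prod_i a i) * Num.sqrt
        (\sum_(j : {ffun 'I_(n - k) -> 'I_n} | increasing j)
           row_minor Omp j ^+ 2 / multi_prod a j ^+ 2))%:E)%E].
Proof.
move=> vol kappa.
have volE : vol = (kappa * (Num.sqrt
    (\sum_(i : {ffun 'I_k -> 'I_n} | increasing i)
       principal_minor P i * multi_prod a i ^+ 2))%:E)%E.
  by apply: subspace_volume_ellipsoid => //; exists Om.
have PE : \sum_(i : {ffun 'I_k -> 'I_n} | increasing i)
      principal_minor P i * multi_prod a i ^+ 2 =
    \sum_(i : {ffun 'I_k -> 'I_n} | increasing i)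
      row_minor Om i ^+ 2 * multi_prod a i ^+ 2.
  rewrite (orthogonal_projectionE hOm hP).
  by apply: eq_bigr => i _; rewrite principal_minor_mul_tr.
have PpE : \sum_(j : {ffun 'I_(n - k) -> 'I_n} | increasing j)
      principal_minor Pp j / multi_prod a j ^+ 2 =
    \sum_(j : {ffun 'I_(n - k) -> 'I_n} | increasing j)
      row_minor Omp j ^+ 2 / multi_prod a j ^+ 2.
  rewrite (orthogonal_projectionE hOmp hPp).
  by apply: eq_bigr => i _; rewrite principal_minor_mul_tr.
have complE : (\prod_i a i) * Num.sqrt
      (\sum_(j : {ffun 'I_(n - k) -> 'I_n} | increasing j)
        row_minor Omp j ^+ 2 / multi_prod a j ^+ 2) =
    Num.sqrt (\sum_(i : {ffun 'I_k -> 'I_n} | increasing i)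
      row_minor Om i ^+ 2 * multi_prod a i ^+ 2).
  have prod_ge0 : 0 <= \prod_i a i by rewrite prodr_ge0// => i _; exact/ltW.
  (* Under the root the prefactor becomes the determinant of [S], the diagonal matrix of the
     [a i ^+ 2]; the complementary identity is used with this [S] and its inverse as [T]. *)
  rewrite -[\prod_i a i]ger0_norm// -sqrtr_sqr -sqrtrM ?sqr_ge0//.
  have a2 m (i : {ffun 'I_m -> 'I_n}) :
      multi_prod a i ^+ 2 = multi_prod (fun l => a l ^+ 2) i.
    by rewrite /multi_prod prodrXl.
  have aV m (i : {ffun 'I_m -> 'I_n}) :
      (multi_prod a i ^+ 2)^-1 = multi_prod (fun l => (a l ^+ 2)^-1) i.
    by rewrite a2 /multi_prod prodfV.
  under [X in Num.sqrt (_ * X)]eq_bigr do rewrite aV.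
  under [in RHS]eq_bigr do rewrite a2.
  rewrite -!det_gram_diag; congr Num.sqrt.
  have -> : (\prod_i a i) ^+ 2 = \det (diag_mx (\row_i (a i ^+ 2))).
    by rewrite det_diag -prodrXl; apply: eq_bigr => i _; rewrite mxE.
  apply: det_compl_orthonormal.
  (* The bound on [k] makes the truncated difference [n - k] the true codimension. *)
  - by rewrite subnKC//; case/andP: hk => _ /leq_trans; apply; exact: leq_subr.
  - exact: orthonormal_basis_mul_tr hOm.
  - exact: orthonormal_basis_mul_tr hOmp.
  - apply/matrixP => i j; rewrite [RHS]mxE.
    transitivity (dotc (col i Om) (col j Omp)).
      by rewrite mxE; apply: eq_bigr => l _; rewrite !mxE.
    by apply: (orthonormal_basis_col hOmp j);
      exact: orthonormal_basis_col hOm i.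
  - rewrite mulmx_diag -diag_const_mx; congr diag_mx; apply/rowP => i.
    by rewrite !mxE divff// sqrf_eq0 gt_eqF.
by split; rewrite volE// PE// ?PpE complE.
Qed.
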